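(* Let $n\geq 1$ be an integer and let $a,b$ be complex numbers at least one of which equals $q^{-n}$ (such that no denominator below vanishes). Then $$2\sum_{k=1}^{n}\frac{(a;q)_k\,(b;q)_k\,(a^2b^2;q)_k}{(-ab;q)_k\,(a^2b^2q;q^2)_k}\,\frac{q^k}{1-q^k}=\sum_{k=1}^{2n}\frac{(a^2;q)_k\,(b^2;q)_k\,(ab;q)_k}{(-ab;q)_k\,(a^2b^2q;q^2)_k}\,\frac{q^k}{1-q^k}.$$
   Context: $q$ is a complex number with $0<|q|<1$. For an integer $k\ge 0$, $(x;p)_k=\prod_{j=0}^{k-1}(1-xp^j)$. *)

(* Defs.v *)
From mathcomp Require Import all_boot all_order all_algebra.
From mathcomp Require Import reals complex.

Set Implicit Arguments.
Unset Strict Implicit.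
Unset Printing Implicit Defensive.

Import Order.TTheory GRing.Theory Num.Theory.
Local Open Scope ring_scope.

(* The q-shifted factorial (x; p)_k. *)
Definition qpoch (F : comNzRingType) (x p : F) (k : nat) : F :=
  \prod_(j < k) (1 - x * p ^+ j).

(* Main.v *)
Require Import Defs.
From mathcomp Require Import all_boot all_order all_algebra.
From mathcomp Require Import reals complex.
From mathcomp Require Import ring zify.

Set Implicit Arguments.
Unset Strict Implicit.
Unset Printing Implicit Defensive.

Import Order.TTheory GRing.Theory Num.Theory.
Local Open Scope ring_scope.
Local Open Scope complex_scope.

(* Put a = q^-n and x = ab.  Up to the factor 2, both sides are series in the
   products (1/v; q)_k (yv; q)_k, with (y, v) = (x, q^n) on the left and
   (y, v) = (x^2, q^(2n)) on the right.  They are derivatives, at a parameter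
   c = 1, of Askey-Wilson polynomials 4phi3; differentiating the three-term
   recurrence in n shows that the successive differences of either series
   satisfy a first-order inhomogeneous recurrence.  Two steps of the one for
   the right-hand side reproduce the one for the left-hand side.  The
   recurrences can be solved when |x| < |q|; since both sides are rational
   functions of x, the identity extends to all admissible x. *)

(** * Difference equations for the terminating series *)

Section Recurrence.
Variable F : fieldType.
Implicit Types (q s t v x y : F) (k n : nat).

Lemma qpochS x q k : qpoch x q k.+1 = qpoch x q k * (1 - x * q ^+ k).
Proof. by rewrite /qpoch big_ord_recr. Qed.

Lemma qpoch0 x q : qpoch x q 0 = 1.
Proof. by rewrite /qpoch big_ord0. Qed.

Lemma qpochSl x q k : qpoch x q k.+1 = (1 - x) * qpoch (x * q) q k.
Proof.
rewrite /qpoch big_ord_recl expr0 mulr1; congr (_ * _).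
by apply: eq_bigr => i _; rewrite exprS mulrA.
Qed.

(* With [x = s * t], [y = s * t ^+ 2] and [m = s ^+ 2 * t], both sides of the
   theorem are instances of [series] below: [(s, t) = (x, 1)] on the left and
   [(s, t) = (1, x)] on the right.  The point [v] stands for [q ^+ n].
   [up_coef] and [down_coef] are the coefficients of the three-term recurrence
   of the Askey-Wilson polynomials with parameters a, b, c, d such that
   a^2 = m, ab = -x, ac = -ad = x sqrt(q), hence abcd/q = y. *)
Definition phi q y v k := qpoch v^-1 q k * qpoch (y * v) q k.

Definition up_coef q s t v :=
  (1 - s * t ^+ 2 * v) * (1 + s * t * v) * (1 - s ^+ 2 * t ^+ 2 * v ^+ 2 * q)
  / ((1 - s * t ^+ 2 * v ^+ 2) * (1 - s * t ^+ 2 * v ^+ 2 * q)).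

Definition down_coef q s t v :=
  s ^+ 2 * t * (1 - v) * (1 - t ^+ 2 * v ^+ 2 / q) * (1 + t * v)
  / ((1 - s * t ^+ 2 * v ^+ 2 / q) * (1 - s * t ^+ 2 * v ^+ 2)).

(** All the values of [f] share the core (q/v; q)_(k-1) (yvq; q)_(k-1) with y = s t^2; once it is
    split off, a rational identity remains. The core requires k >= 1, so k = 0 is checked apart. *)
Lemma phi_recurrence q s t v k : q != 0 -> v != 0 ->
  1 - s * t ^+ 2 * v ^+ 2 / q != 0 -> 1 - s * t ^+ 2 * v ^+ 2 != 0 ->
  1 - s * t ^+ 2 * v ^+ 2 * q != 0 ->
  let f := phi q (s * t ^+ 2) in
  up_coef q s t v * (f (v * q) k.+1 - f v k.+1)
  - down_coef q s t v * (f v k.+1 - f (v / q) k.+1)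
  = (q ^- k.+1 - 1) * (1 - s ^+ 2 * t * q ^+ k.+1) * f v k.+1
  - q ^- k.+1 * (1 + s * t * q ^+ k) * (1 - (s * t) ^+ 2 * q * q ^+ 2 ^+ k)
    * (1 - q ^+ k.+1) * f v k.
Proof.
move=> q0 v0 h1 h2 h3 /=.
have d1 : q - s * t ^+ 2 * v ^+ 2 != 0.
  by apply: contraNneq h1 => e; rewrite -[1](mulfV q0) -mulrBl e mul0r.
rewrite /phi /up_coef /down_coef; set y := s * t ^+ 2; case: k => [|k].
  rewrite !qpochS !qpoch0 !expr0 !mulr1 !mul1r {}/y.
  by field; rewrite q0 v0 h2 d1 h3.
have -> : (v * q)^-1 = v^-1 / q by rewrite invfM.
have -> : (v / q)^-1 = v^-1 * q by rewrite invfM invrK.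
rewrite [qpoch v^-1 q k.+2]qpochSl [qpoch (y * v) q k.+2]qpochSl.
rewrite [qpoch v^-1 q k.+1]qpochSl [qpoch (y * v) q k.+1]qpochSl.
rewrite [qpoch (v^-1 / q) _ _]qpochSl [qpoch (y * (v / q)) _ _]qpochSl.
rewrite mulfVK // -[y * (v / q) * q]mulrA mulfVK // mulrA.
rewrite [qpoch v^-1 q k.+1]qpochSl [qpoch (y * v) q k.+1]qpochSl.
rewrite !qpochS (exprAC q 2) !(exprS q k.+1) !(exprS q k).
have Q0 : q ^+ k != 0 by rewrite expf_neq0.
move: (qpoch _ _ _) (qpoch _ _ _) (q ^+ k) Q0 => f g Q Q0.
by rewrite {}/y; field; rewrite q0 v0 h2 d1 h3 Q0.
Qed.

Definition den q x k := qpoch (- x) q k * qpoch (x ^+ 2 * q) (q ^+ 2) k.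

Definition series q s t M v := \sum_(1 <= k < M.+1)
  phi q (s * t ^+ 2) v k * qpoch (s ^+ 2 * t) q k / den q (s * t) k
  * (q ^+ k / (1 - q ^+ k)).

Lemma series_recurrence q s t v M : q != 0 -> v != 0 ->
  (forall k, 1 - q ^+ k.+1 != 0) ->
  (forall k, den q (s * t) k != 0) ->
  1 - s * t ^+ 2 * v ^+ 2 / q != 0 -> 1 - s * t ^+ 2 * v ^+ 2 != 0 ->
  1 - s * t ^+ 2 * v ^+ 2 * q != 0 ->
  phi q (s * t ^+ 2) v M = 0 ->
  up_coef q s t v * (series q s t M (v * q) - series q s t M v)
  - down_coef q s t v * (series q s t M v - series q s t M (v / q))
  = - (1 - s ^+ 2 * t).
Proof.
move=> q0 v0 hq hd h1 h2 h3 phiM.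
(* The two terms of [phi_recurrence] telescope against the coefficients. *)
pose G k := qpoch (s ^+ 2 * t) q k.+1 * phi q (s * t ^+ 2) v k
            / den q (s * t) k.
rewrite /series !big_add1 /= -!sumrB !mulr_sumr -sumrB.
rewrite (eq_bigr (fun k => G k.+1 - G k)) => [|k _]; last first.
  transitivity ((up_coef q s t v * (phi q (s * t ^+ 2) (v * q) k.+1
                               - phi q (s * t ^+ 2) v k.+1)
    - down_coef q s t v * (phi q (s * t ^+ 2) v k.+1
                      - phi q (s * t ^+ 2) (v / q) k.+1))
    * (qpoch (s ^+ 2 * t) q k.+1 / den q (s * t) k.+1
       * (q ^+ k.+1 / (1 - q ^+ k.+1)))); first by ring.
  rewrite phi_recurrence //= /G.
  have := hd k.+1; have := hd k; have := hq k; rewrite /den.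
  rewrite !(qpochS (s ^+ 2 * t)) !(qpochS (- (s * t)))
    !(qpochS ((s * t) ^+ 2 * q)).
  have qk : q ^+ k != 0 by rewrite expf_neq0.
  rewrite (exprAC q 2) !(exprS q k).
  move: (phi _ _ _ _) (phi _ _ _ _) => f g.
  rewrite !mulf_eq0 !negb_or => hk /andP[d1 d2] /andP[/andP[_ d3] /andP[_ d4]].
  by field; rewrite d1 d2 d3 d4 hk qk.
(* The end term [G M] vanishes with [phi] at [M], and [G 0] = 1 - s^2 t supplies the right-hand
   side. *)
rewrite telescope_sumr // /G phiM mulr0 mul0r add0r.
by rewrite /phi /den !qpochS !qpoch0 !mul1r mulr1 divr1 expr0 mulr1.
Qed.

Lemma qpoch_eq0 x q k j : (j < k)%N -> x * q ^+ j = 1 -> qpoch x q k = 0.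
Proof.
by move=> ltjk xq; rewrite /qpoch (bigD1 (Ordinal ltjk)) //= xq subrr mul0r.
Qed.

Lemma phi_eq0 q y n k : q != 0 -> (n < k)%N -> phi q y (q ^+ n) k = 0.
Proof.
move=> q0 ltnk; rewrite /phi (qpoch_eq0 ltnk) ?mul0r //.
by rewrite mulVf // expf_neq0.
Qed.

Lemma affine_solve (a V c d : F) : a != 0 -> a * V - c = d -> V = (c + d) / a.
Proof. by move=> a0 <-; rewrite addrC subrK mulrC mulKf. Qed.

(* [U0] and [U1] are the differences of the left-hand series from n to n+1 and
   from n+1 to n+2; [V0], ..., [V3] are those of the right-hand series from
   2n+i to 2n+i+1. *)
Lemma recurrences_agree q x v V0 V1 V2 V3 U0 U1 : q != 0 ->
  1 - x ^+ 2 * (v ^+ 2 * q) != 0 ->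
  1 - x ^+ 2 * (v ^+ 2 * q ^+ 2) != 0 ->
  1 - x ^+ 2 * (v ^+ 2 * q ^+ 3) != 0 ->
  1 - x * (v ^+ 2 * q) != 0 ->
  1 - x * (v ^+ 2 * q ^+ 2) != 0 ->
  1 - x * (v ^+ 2 * q ^+ 3) != 0 ->
  (1 - x ^+ 2 * (v ^+ 2 * q)) * V1 - x * (1 - v ^+ 2 * q) * V0
    = - (1 - x) * (1 - x * (v ^+ 2 * q)) ->
  (1 - x ^+ 2 * (v ^+ 2 * q ^+ 2)) * V2 - x * (1 - v ^+ 2 * q ^+ 2) * V1
    = - (1 - x) * (1 - x * (v ^+ 2 * q ^+ 2)) ->
  (1 - x ^+ 2 * (v ^+ 2 * q ^+ 3)) * V3 - x * (1 - v ^+ 2 * q ^+ 3) * V2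
    = - (1 - x) * (1 - x * (v ^+ 2 * q ^+ 3)) ->
  up_coef q x 1 (v * q) * U1 - down_coef q x 1 (v * q) * U0
    = - (1 - x ^+ 2 * 1) ->
  2 * U0 = V0 + V1 -> 2 * U1 = V2 + V3.
Proof.
move=> q0 a1 a2 a3 b1 b2 b3 e1 e2 e3 eU IH.
move/(affine_solve a1): e1 => e1.
move/(affine_solve a2): e2 => e2.
move/(affine_solve a3): e3 => e3.
(* The factors 1 - xvq and 1 + xvq merge, so the numerator of [up_coef] is the product of the
   leading coefficients in the recurrences giving [V2] and [V3]; that of [down_coef] is the product
   of the lower coefficients in those giving [V1] and [V2]. *)
have upE : up_coef q x 1 (v * q)
   = (1 - x ^+ 2 * (v ^+ 2 * q ^+ 2)) * (1 - x ^+ 2 * (v ^+ 2 * q ^+ 3))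
   / ((1 - x * (v ^+ 2 * q ^+ 2)) * (1 - x * (v ^+ 2 * q ^+ 3))).
  by rewrite /up_coef; congr (_ / _); ring.
have up0 : up_coef q x 1 (v * q) != 0.
  by rewrite upE mulf_neq0 ?invr_eq0 ?mulf_neq0.
move/(affine_solve up0): eU => ->.
have downE : down_coef q x 1 (v * q)
   = x ^+ 2 * (1 - v ^+ 2 * q ^+ 2) * (1 - v ^+ 2 * q)
   / ((1 - x * (v ^+ 2 * q)) * (1 - x * (v ^+ 2 * q ^+ 2))).
  by rewrite /down_coef; field; rewrite b1 q0 !andbT exprMn.
have -> (d : F) : 2 * ((d * U0 - (1 - x ^+ 2 * 1)) / up_coef q x 1 (v * q))
    = (d * (V0 + V1) - 2 * (1 - x ^+ 2)) / up_coef q x 1 (v * q).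
  by rewrite -IH; ring.
(* Eliminating [V3], [V2], [V1] in turn leaves a rational identity in [V0], x, q and v^2. *)
rewrite upE downE e3 e2 e1.
move: (v ^+ 2) a1 a2 a3 b1 b2 b3 => w a1 a2 a3 b1 b2 b3.
by field; rewrite a1 a2 a3 b1 b2 b3.
Qed.
End Recurrence.

(** * The identity for |x| < |q| *)

Section SmallProduct.
Variable F : numFieldType.
Implicit Types (q r x w : F).

Lemma one_sub_mul_neq0 x w : `|x| < 1 -> `|w| <= 1 -> 1 - x * w != 0.
Proof.
move=> x1 w1; rewrite subr_eq0; apply/eqP => e.
have : `|x * w| < 1 by rewrite normrM (le_lt_trans _ x1) // ler_piMr.
by rewrite -e normr1 ltxx.
Qed.

Lemma norm_expr_le1 q k : `|q| < 1 -> `|q ^+ k| <= 1.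
Proof. by move=> q1; rewrite normrX exprn_ile1 // ltW. Qed.

Lemma small_den_neq0 q x k : `|q| < 1 -> `|x| < 1 -> den q x k != 0.
Proof.
move=> q1 x1; rewrite mulf_neq0 //; apply/prodf_neq0 => /= i _.
  by rewrite one_sub_mul_neq0 ?normrN ?norm_expr_le1.
rewrite exprAC -mulrA -exprM -exprS one_sub_mul_neq0 ?norm_expr_le1 //.
by rewrite normrX exprn_ilt1.
Qed.

(** For |x| < |q| no denominator or leading coefficient of the recurrences vanishes, not even 1 -
    x/q at v = 1, so the differences of both series are determined step by step. One step on the
    left matches two on the right. The cutoff [M] is shared so that neighbouring series subtract
    termwise. *)
Lemma small_identity q x M n : 0 < `|q| -> `|q| < 1 -> `|x| < `|q| ->
  (2 * n <= M)%N ->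
  2 * series q x 1 M (q ^+ n) = series q 1 x M (q ^+ (2 * n)).
Proof.
move=> q_gt0 q1 xq leM.
have q0 : q != 0 by rewrite -normr_gt0.
have x1 : `|x| < 1 := lt_trans xq q1.
have xxq : `|x ^+ 2| < `|q|.
  by rewrite normrX expr2 (le_lt_trans _ xq) // ler_piMr // ltW.
have xx1 : `|x ^+ 2| < 1 := lt_trans xxq q1.
have qle k : `|q ^+ k| <= 1 by apply: norm_expr_le1.
have qlt y : `|y| < `|q| -> `|y / q| < 1.
  by move=> yq; rewrite normrM normfV ltr_pdivrMr // mul1r.
have den0 k : den q x k != 0 by apply: small_den_neq0.
have qn1 k : 1 - q ^+ k.+1 != 0 by rewrite exprS one_sub_mul_neq0.
pose U k := series q x 1 M (q ^+ k.+1) - series q x 1 M (q ^+ k).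
pose V k := series q 1 x M (q ^+ k.+1) - series q 1 x M (q ^+ k).
(* A separate backward difference covers k = 0, where it involves q^-1 but enters with coefficient 1
   - q^0 = 0. *)
pose W k := series q 1 x M (q ^+ k) - series q 1 x M (q ^+ k / q).
have WE k : W k.+1 = V k by rewrite /W /V exprSr mulfK.
have recV k : (k < M)%N ->
    (1 - x ^+ 2 * q ^+ k) * V k - x * (1 - q ^+ k) * W k
    = - (1 - x) * (1 - x * q ^+ k).
  move=> ltkM.
  have := @series_recurrence F q 1 x (q ^+ k) M q0 _ qn1.
  rewrite mul1r -exprM -exprSr.
  have h1 : 1 - x ^+ 2 * q ^+ (k * 2) / q != 0
    by rewrite mulrAC one_sub_mul_neq0 ?qlt.
  have h2 : 1 - x ^+ 2 * q ^+ (k * 2) != 0 by rewrite one_sub_mul_neq0.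
  have h3 : 1 - x ^+ 2 * q ^+ (k * 2) * q != 0
    by rewrite -mulrA -exprSr one_sub_mul_neq0.
  rewrite mul1r expf_neq0 // phi_eq0 // => /(_ isT den0 h1 h2 h3 erefl).
  rewrite -/(V k) -/(W k).
  (* For s = 1, t = x and v = q^k the coefficients reduce to (1 - x^2 v)/(1 - xv) and x(1 - v)/(1 -
     xv); the factor 1 - x q^k clears both. *)
  have -> : - (1 - x) * (1 - x * q ^+ k)
      = - (1 - 1 ^+ 2 * x) * (1 - x * q ^+ k) by ring.
  move=> <-; rewrite /up_coef /down_coef exprM in h1 h2 h3 *.
  have d1 : q - x ^+ 2 * q ^+ k ^+ 2 != 0.
    by apply: contraNneq h1 => e; rewrite -[1](mulfV q0) -mulrBl e mul0r.
  by field; rewrite exprMn h2 h3 q0 d1.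
pose Z k := series q x 1 M (q ^+ k) - series q x 1 M (q ^+ k / q).
have ZE k : Z k.+1 = U k by rewrite /Z /U exprSr mulfK.
have recU k : (k < M)%N ->
    up_coef q x 1 (q ^+ k) * U k - down_coef q x 1 (q ^+ k) * Z k
    = - (1 - x ^+ 2 * 1).
  move=> ltkM; rewrite /U exprSr series_recurrence ?expf_neq0 ?phi_eq0 //.
  - by move=> j; rewrite mulr1.
  - by rewrite expr1n mulr1 mulrAC -exprM one_sub_mul_neq0 ?qlt.
  - by rewrite expr1n mulr1 -exprM one_sub_mul_neq0.
  - by rewrite expr1n mulr1 -exprM -mulrA -exprSr one_sub_mul_neq0.
have recV' k : (k.+1 < M)%N ->
    (1 - x ^+ 2 * q ^+ k.+1) * V k.+1 - x * (1 - q ^+ k.+1) * V k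
    = - (1 - x) * (1 - x * q ^+ k.+1).
  by move=> ltkM; rewrite -(WE k) recV.
have UV k : (2 * k + 1 < M)%N -> 2 * U k = V (2 * k)%N + V (2 * k).+1.
  elim: k => [|k IH] ltkM.
    (* At v = 1 the factor 1 - v removes the backward differences, so the first differences are
       explicit. *)
    have onex : 1 - x != 0 by rewrite -[x]mulr1 one_sub_mul_neq0 ?normr1.
    have onexN : 1 + x != 0.
      by rewrite -[x]mulr1 -[x]opprK mulNr one_sub_mul_neq0 ?normrN ?normr1.
    have onexq : 1 - x * q != 0 by rewrite one_sub_mul_neq0 // ltW.
    have onexxq : 1 - x ^+ 2 * q != 0 by rewrite one_sub_mul_neq0 // ltW.
    have onexx : 1 - x ^+ 2 != 0.
      by rewrite -[_ ^+ 2]mulr1 one_sub_mul_neq0 ?normr1.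
    have down0 : down_coef q x 1 1 = 0 by rewrite /down_coef subrr mulr0 !mul0r.
    have up0 : up_coef q x 1 1 = (1 + x) * (1 - x ^+ 2 * q) / (1 - x * q).
      by rewrite /up_coef !expr1n !mulr1; field; rewrite onex onexq.
    have := recU 0 (ltn_trans (ltnSn 0) ltkM).
    rewrite expr0 up0 down0 => /affine_solve ->; last first.
      by rewrite !mulf_neq0 ?invr_eq0.
    rewrite muln0; have := recV' 0 ltkM.
    rewrite expr1 => /(affine_solve onexxq) ->.
    have := recV 0 (ltn_trans (ltnSn 0) ltkM).
    rewrite expr0 mulr1 => /(affine_solve onexx) ->.
    by field; rewrite ?onexN ?onexq ?onexx ?onexxq.
  have e1 : q ^+ (2 * k).+1 = (q ^+ k) ^+ 2 * q by rewrite exprSr mulnC exprM.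
  have e2 : q ^+ (2 * k).+2 = (q ^+ k) ^+ 2 * q ^+ 2.
    by rewrite -addn2 exprD mulnC exprM.
  have e3 : q ^+ (2 * k).+3 = (q ^+ k) ^+ 2 * q ^+ 3.
    by rewrite -addn3 exprD mulnC exprM.
  rewrite mulnS !addSn add0n.
  apply: (@recurrences_agree _ q x (q ^+ k)
            (V (2 * k)%N) (V (2 * k).+1) _ _ (U k));
    rewrite // -?e1 -?e2 -?e3 ?one_sub_mul_neq0 ?recV' ?IH //; try lia.
  by rewrite -exprSr -(ZE k) recU //; lia.
elim: n leM => [|k IH] leM.
  have series0 s t : series q s t M 1 = 0.
    rewrite /series big_nat big1 // => k /andP[k_gt0 _].
    by rewrite -(expr0 q) phi_eq0 // !mul0r.
  by rewrite !expr0 !series0 mulr0.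
have -> : series q x 1 M (q ^+ k.+1) = series q x 1 M (q ^+ k) + U k.
  by rewrite /U addrC subrK.
rewrite mulrDr IH ?UV; try lia.
by rewrite /V mulnS !addSn add0n; ring.
Qed.

(** * Extension to all admissible x *)

(** The points r/2, r/3, ... provide [size p] distinct roots of norm below r, too many for a nonzero
    p. *)
Lemma poly_eq0_small r (p : {poly F}) : 0 < r ->
  (forall x, `|x| < r -> p.[x] = 0) -> p = 0.
Proof.
move=> r0 hp; apply/eqP; apply: contraT => p0.
pose rs := [seq r / i.+2%:R | i <- iota 0 (size p)].
have: (size rs < size p)%N.
  apply: max_poly_roots => //.
    apply/allP => _ /mapP[i _ ->]; rewrite rootE hp //.
    rewrite ger0_norm ?divr_ge0 ?ler0n ?ltW // ltr_pdivrMr ?ltr0n //.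
    by rewrite ltr_pMr // ltr1n.
  rewrite map_inj_uniq ?iota_uniq // => i j.
  move=> /(mulfI (lt0r_neq0 r0)) /invr_inj /eqP.
  by rewrite eqr_nat => /eqP [].
by rewrite size_map size_iota ltnn.
Qed.

(** Clearing denominators turns the sum into a polynomial [P] that vanishes near 0, hence
    identically; dividing back is legitimate wherever no [d i] vanishes. *)
Lemma sum_fractions_eq0 (I : finType) r (p d : I -> {poly F}) : 0 < r ->
  (forall x, `|x| < r ->
     (forall i, (d i).[x] != 0) /\ \sum_i (p i).[x] / (d i).[x] = 0) ->
  forall x, (forall i, (d i).[x] != 0) -> \sum_i (p i).[x] / (d i).[x] = 0.
Proof.
move=> r0 small x dx.
pose P := \sum_i p i * \prod_(j | j != i) d j.
have PE y : (forall i, (d i).[y] != 0) ->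
    P.[y] = (\prod_i (d i).[y]) * \sum_i (p i).[y] / (d i).[y].
  move=> dy; rewrite horner_sum mulr_sumr; apply: eq_bigr => i _.
  rewrite hornerM horner_prod [in RHS](bigD1 i) //=.
  by field; rewrite dy.
have P0 : P = 0.
  apply: (poly_eq0_small r0) => y /small[dy sy].
  by rewrite PE // sy mulr0.
have /eqP := PE x dx; rewrite P0 horner0 eq_sym mulf_eq0 => /orP[|/eqP //].
by rewrite prodf_seq_eq0 => /hasP[i _ /=]; rewrite (negPf (dx i)).
Qed.

Lemma horner_qpoch (P Q : {poly F}) k x :
  (qpoch P Q k).[x] = qpoch P.[x] Q.[x] k.
Proof. by rewrite horner_prod; apply: eq_bigr => i _; rewrite !hornerE. Qed.

Lemma rational_identity q n x : 0 < `|q| -> `|q| < 1 ->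
  (forall k, (1 <= k <= 2 * n)%N -> den q x k != 0) ->
  2 * series q x 1 (2 * n) (q ^+ n) = series q 1 x (2 * n) (q ^+ (2 * n)).
Proof.
move=> q_gt0 q1 hden.
pose w k := q ^+ k / (1 - q ^+ k).
(* The index i stands for k = i + 1. Both series, cut off at 2n, are merged termwise over the common
   denominator [d i], a polynomial in x. *)
pose p (i : 'I_(2 * n)) : {poly F} := let k := i.+1 in
  (2 * qpoch (q ^- n)%:P q%:P k * qpoch ('X * (q ^+ n)%:P) q%:P k
       * qpoch ('X ^+ 2) q%:P k
   - qpoch (q ^- (2 * n))%:P q%:P k * qpoch ('X ^+ 2 * (q ^+ (2 * n))%:P) q%:P k
       * qpoch 'X q%:P k) * (w k)%:P.
pose d (i : 'I_(2 * n)) : {poly F} :=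
  qpoch (- 'X) q%:P i.+1 * qpoch ('X ^+ 2 * q%:P) (q%:P ^+ 2) i.+1.
have dE i y : (d i).[y] = den q y i.+1.
  by rewrite hornerM !horner_qpoch !hornerE.
have sumE y : \sum_i (p i).[y] / (d i).[y]
    = 2 * series q y 1 (2 * n) (q ^+ n) - series q 1 y (2 * n) (q ^+ (2 * n)).
  rewrite /series !big_add1 /= !big_mkord mulr_sumr -sumrB.
  apply: eq_bigr => i _; rewrite dE /phi !expr1n !mulr1 !mul1r.
  have -> : (p i).[y] = (2 * qpoch (q ^- n) q i.+1 * qpoch (y * q ^+ n) q i.+1
        * qpoch (y ^+ 2) q i.+1
      - qpoch (q ^- (2 * n)) q i.+1 * qpoch (y ^+ 2 * q ^+ (2 * n)) q i.+1
        * qpoch y q i.+1) * w i.+1.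
    by rewrite /p !hornerE !horner_qpoch !hornerE.
  by rewrite /w; ring.
apply/eqP; rewrite -subr_eq0 -sumE; apply/eqP.
apply: (sum_fractions_eq0 q_gt0) => [y yq|i]; last first.
  by rewrite dE hden //= ltn_ord.
split=> [i|]; first by rewrite dE small_den_neq0 // (lt_trans yq).
by rewrite sumE small_identity // subrr.
Qed.

(** * Return to the parameters a and b *)

(** With x = ab, the choice a = q^-n gives b = x q^n, a^2 = q^(-2n) and b^2 = x^2 q^(2n), which
    turns the two series in x into the two sums. *)
Lemma sum_identity q n a b : 0 < `|q| -> `|q| < 1 -> a = q ^- n ->
    (forall k : nat, (1 <= k <= 2 * n)%N ->
       qpoch (- (a * b)) q k != 0 /\
       qpoch (a ^+ 2 * b ^+ 2 * q) (q ^+ 2) k != 0) ->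
  2 * (\sum_(1 <= k < n.+1)
         (qpoch a q k * qpoch b q k * qpoch (a ^+ 2 * b ^+ 2) q k)
         / (qpoch (- (a * b)) q k * qpoch (a ^+ 2 * b ^+ 2 * q) (q ^+ 2) k)
         * (q ^+ k / (1 - q ^+ k)))
  = \sum_(1 <= k < (2 * n).+1)
         (qpoch (a ^+ 2) q k * qpoch (b ^+ 2) q k * qpoch (a * b) q k)
         / (qpoch (- (a * b)) q k * qpoch (a ^+ 2 * b ^+ 2 * q) (q ^+ 2) k)
         * (q ^+ k / (1 - q ^+ k)).
Proof.
move=> q_gt0 q1 aE hden.
have q0 : q != 0 by rewrite -normr_gt0.
have qn0 j : q ^+ j != 0 by rewrite expf_neq0.
have bE : a * b * q ^+ n = b by rewrite aE mulrAC mulVf ?mul1r.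
have a2E : a ^+ 2 = q ^- (2 * n) by rewrite aE exprVn -exprM mulnC.
have b2E : (a * b) ^+ 2 * q ^+ (2 * n) = b ^+ 2.
  by rewrite exprMn a2E mulrAC mulVf ?mul1r.
have := @rational_identity q n (a * b) q_gt0 q1.
rewrite /series /phi /den !expr1n !mulr1 !mul1r bE b2E -aE -a2E exprMn.
move=> <- => [|k /hden [d1 d2]]; last by rewrite mulf_neq0.
(* The left series runs up to 2n, but (q^-n; q)_k = 0 for k > n. *)
congr (_ * _); rewrite [in RHS](big_cat_nat (n := n.+1)) //=; last by lia.
rewrite [X in _ = _ + X]big_nat [X in _ = _ + X]big1 ?addr0 // => k.
by move=> /andP[ltnk _]; rewrite aE (qpoch_eq0 ltnk) ?mul0r // mulVf.
Qed.
End SmallProduct.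

Theorem theorem3p2 (R : realType) (q : R[i]) (hq0 : 0 < `|q|) (hq1 : `|q| < 1)
    (n : nat) (hn : (1 <= n)%N) (a b : R[i])
    (hab : a = q ^- n \/ b = q ^- n)
    (hden : forall k : nat, (1 <= k <= 2 * n)%N ->
       qpoch (- (a * b)) q k != 0 /\
       qpoch (a ^+ 2 * b ^+ 2 * q) (q ^+ 2) k != 0) :
  2 * (\sum_(1 <= k < n.+1)
         (qpoch a q k * qpoch b q k * qpoch (a ^+ 2 * b ^+ 2) q k)
         / (qpoch (- (a * b)) q k * qpoch (a ^+ 2 * b ^+ 2 * q) (q ^+ 2) k)
         * (q ^+ k / (1 - q ^+ k)))
  = \sum_(1 <= k < (2 * n).+1)
         (qpoch (a ^+ 2) q k * qpoch (b ^+ 2) q k * qpoch (a * b) q k)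
         / (qpoch (- (a * b)) q k * qpoch (a ^+ 2 * b ^+ 2 * q) (q ^+ 2) k)
         * (q ^+ k / (1 - q ^+ k)).
Proof.
case: hab => [aE|bE]; first exact: sum_identity.
(* Both sides are symmetric in a and b, so the roles are exchanged. *)
have := @sum_identity _ q n b a hq0 hq1 bE; rewrite (mulrC b a) (mulrC (b ^+ 2)).
move=> /(_ hden) e; transitivity (2 * \sum_(1 <= k < n.+1)
    qpoch b q k * qpoch a q k * qpoch (a ^+ 2 * b ^+ 2) q k
    / (qpoch (- (a * b)) q k * qpoch (a ^+ 2 * b ^+ 2 * q) (q ^+ 2) k)
    * (q ^+ k / (1 - q ^+ k))).
  by congr (_ * _); apply: eq_bigr => k _; rewrite (mulrC (qpoch a q k)).
by rewrite e; apply: eq_bigr => k _; rewrite (mulrC (qpoch (b ^+ 2) q k)).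
Qed.
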